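(* Assume that $h_{0,0}\,B(\gamma,1-\gamma+\beta+r\alpha)\neq 1$ for all $r=0,1,2,\dots$, and that the perturbation term has the form $\mathcal H_n(t)=\sum_{r\in\mathcal S}\tau_{n,r}P_{n+\vartheta_n-r,\alpha}(t)$, where the index set turns out to be $\mathcal S=\{0,1,\dots,\vartheta_n-1\}$. Then the exact polynomial solution $y_n\in\mathrm{span}\{1,t^\alpha,\dots,t^{n\alpha}\}$ (Tau-solution) of the perturbed problem $$\widetilde{\mathcal L}y_n(t)=\widetilde g(t)+\mathcal H_n(t)$$ is given by $$y_n(t)=\sum_{r=0}^{n}g_r\psi_r(t)+\sum_{r=0}^{\vartheta_n-1}\tau_{n,r}\left(\sum_{j=0}^{n+\vartheta_n-r}C_{n+\vartheta_n-r,j}\,\psi_j(t)\right),$$ where the parameters $\overline\tau=(\tau_{n,0},\dots,\tau_{n,\vartheta_n-1})^T$ are determined by solving the $\vartheta_n$-dimensional linear algebraic system $\mathcal M\overline\tau=\mathcal B$ whose entries, for $\ell,r=0,\dots,\vartheta_n-1$ ($\ell$ the row index and $r$ the column index), are $$\mathcal M_{\ell,r}=\sum_{j=0}^{n+\vartheta_n-r}C_{n+\vartheta_n-r,j}\,d_{j,\ell},\qquad \mathcal B_\ell=-\sum_{r=0}^{n}g_r\,d_{r,\ell}.$$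
   Context: Parameters: $0<\gamma\le 1$, $\beta>0$, $\beta\ge\gamma$, $\gamma=p_1/q_1$, $\beta=p_2/q_2$ with $p_i,q_i$ positive integers, coprime for each $i$. Put $\delta=\mathrm{lcm}(q_1,q_2)$, $\alpha=1/\delta$, $\sigma_1=p_1\delta/q_1$, $\sigma_2=p_2\delta/q_2$, so $\gamma=\sigma_1\alpha$, $\beta=\sigma_2\alpha$. $B(\cdot,\cdot)$ is the Beta function. Fix $n\ge 0$, $\widetilde g(t)=\sum_{i=0}^n g_it^{i\alpha}$ and $\widetilde H(t,s)=\sum_{i,j=0}^{n}h_{i,j}t^{i\alpha}s^{j\alpha}$ with real coefficients. A fractional polynomial is a finite linear combination of $t^{r\alpha}$, $r=0,1,2,\dots$. On fractional polynomials define the linear operator $$(\widetilde{\mathcal L}y)(t)=y(t)-\int_0^t t^{-\beta}(t-s)^{\gamma-1}s^{\beta-\gamma}\widetilde H(t,s)y(s)\,ds .$$ Then $\widetilde{\mathcal L}(t^{r\alpha})=t^{r\alpha}-\sum_{i,j=0}^{n}h_{i,j}B\big(\sigma_1\alpha,(r+j+\sigma_2-\sigma_1)\alpha+1\big)t^{(r+i+j)\alpha}$, which is written as $\sum_{\ell=r}^{r+\vartheta_n}S_{\ell,r}t^{\ell\alpha}$ for all $r\ge0$. This defines the coefficients $S_{\ell,r}$, and $\vartheta_n\in\{0,1,\dots,2n\}$ is called the height of $\widetilde{\mathcal L}$; it is understood that $S_{r+\vartheta_n,r}\ne0$ for all $r\ge 0$. The associated FC-polynomials $\psi_r$ and numbers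 $d_{r,j}$ ($r\ge 0$, $0\le j\le\vartheta_n-1$) are defined recursively by $\psi_r=0$, $d_{r,j}=\delta_{r,j}$ (Kronecker delta) for $r,j=0,\dots,\vartheta_n-1$, and, for $r\ge0$, $$\psi_{r+\vartheta_n}(t)=\frac{1}{S_{r+\vartheta_n,r}}\Big(t^{r\alpha}-\sum_{\ell=r}^{r+\vartheta_n-1}S_{\ell,r}\psi_\ell(t)\Big),\qquad d_{r+\vartheta_n,j}=\frac{-1}{S_{r+\vartheta_n,r}}\sum_{\ell=r}^{r+\vartheta_n-1}d_{\ell,j}S_{\ell,r}.$$ The shifted fractional Legendre polynomials are $P_{i,\alpha}(t)=\sum_{j=0}^{i}C_{i,j}t^{j\alpha}$ with $C_{i,j}=\frac{(-1)^{i+j}(i+j)!}{(i-j)!(j!)^2}$. The parameters $\tau_{n,r}$ (and the set $\mathcal S$) in $\mathcal H_n$ are unknowns to be determined along with $y_n$. *)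

(* Defs.v *)
From mathcomp Require Import all_boot all_order all_algebra.
From mathcomp Require Import all_classical all_reals all_analysis.

Set Implicit Arguments.
Unset Strict Implicit.
Unset Printing Implicit Defensive.

Import Order.TTheory GRing.Theory Num.Theory.

Local Open Scope classical_set_scope.
Local Open Scope ring_scope.

(* The Euler integral for real a, b > 0 (the library's [beta_fun] only takes
   natural arguments). *)
Definition Beta (R : realType) (a b : R) : R :=
  \int[lebesgue_measure]_(x in `[0, 1]) (x `^ (a - 1) * (1 - x) `^ (b - 1)).

(* Membership in span{1, t^alpha, ..., t^(n alpha)}, as functions on [0, +oo):
   the values at t < 0 are irrelevant. *)
Definition fracpoly_span (R : realType) (alpha : R) (n : nat) (y : R -> R) : Prop :=
  exists c : 'I_n.+1 -> R,
    forall t : R, 0 <= t -> y t = \sum_(i < n.+1) c i * t `^ (i%:R * alpha).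

Definition gtilde (R : realType) (alpha : R) (n : nat) (g : 'I_n.+1 -> R) (t : R) : R :=
  \sum_(i < n.+1) g i * t `^ (i%:R * alpha).

Definition Htilde (R : realType) (alpha : R) (n : nat) (h : 'M[R]_n.+1) (t s : R) : R :=
  \sum_(i < n.+1) \sum_(j < n.+1) h i j * t `^ (i%:R * alpha) * s `^ (j%:R * alpha).

(* Meaningful for t > 0; the library's total integral makes sense of it for
   every y, and it is only applied to fractional polynomials. *)
Definition Lop (R : realType) (gamma beta alpha : R) (n : nat) (h : 'M[R]_n.+1)
    (y : R -> R) (t : R) : R :=
  y t - \int[lebesgue_measure]_(s in `[0, t])
          (t `^ (- beta) * (t - s) `^ (gamma - 1) * s `^ (beta - gamma)
             * Htilde alpha h t s * y s).

(* The coefficient of t^(l alpha) in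
   t^(r alpha) - \sum_(i, j) h_ij
     B(sigma1 alpha, (r + j + sigma2 - sigma1) alpha + 1) t^((r + i + j) alpha),
   the expansion of Lop at t^(r alpha). *)
Definition Scoef (R : realType) (alpha : R) (sigma1 sigma2 : nat) (n : nat)
    (h : 'M[R]_n.+1) (l r : nat) : R :=
  (l == r)%:R -
  \sum_(i < n.+1) \sum_(j < n.+1 | (r + i + j == l)%N)
     h i j * Beta (sigma1%:R * alpha)
                  ((r%:R + j%:R + sigma2%:R - sigma1%:R) * alpha + 1).

Definition is_height (R : realType) (n : nat) (S : nat -> nat -> R) (theta : nat) : Prop :=
  [/\ (theta <= n.*2)%N,
      forall r l : nat, (r + theta < l)%N -> S l r = 0
    & forall r : nat, S (r + theta)%N r != 0].

(* Course-of-values recursion: [F m f] may use f only below m; see [covrecE]. *)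
Fixpoint covhist (R : realType) (F : nat -> (nat -> R) -> R) (m : nat) : nat -> R :=
  if m is k.+1 then
    fun l => if l == k then F k (covhist F k) else covhist F k l
  else fun=> 0.

Definition covrec (R : realType) (F : nat -> (nat -> R) -> R) (m : nat) : R :=
  F m (covhist F m).

Lemma covhistE (R : realType) (F : nat -> (nat -> R) -> R) (m l : nat) :
  (l < m)%N -> covhist F m l = covrec F l.
Proof.
elim: m => // m IHm; rewrite ltnS leq_eqVlt /= => /predU1P[->|lm].
  by rewrite eqxx.
by rewrite (ltn_eqF lm) IHm.
Qed.

Lemma covrecE (R : realType) (F : nat -> (nat -> R) -> R) (m : nat) :
  (forall f f' : nat -> R, (forall l, (l < m)%N -> f l = f' l) -> F m f = F m f') ->
  covrec F m = F m (covrec F).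
Proof. by move=> HF; apply: HF => l; apply: covhistE. Qed.

(* The FC-polynomials; their recursion is unfolded in [psi_lt] and [psi_addn]. *)
Definition psi (R : realType) (alpha : R) (S : nat -> nat -> R) (theta r : nat) (t : R) : R :=
  covrec (fun m f =>
    if (m < theta)%N then 0
    else (S m (m - theta)%N)^-1 *
         (t `^ ((m - theta)%:R * alpha)
            - \sum_(m - theta <= l < m) S l (m - theta)%N * f l)) r.

(* The numbers d_{r,j}; their recursion is unfolded in [dcoef_lt] and [dcoef_addn]. *)
Definition dcoef (R : realType) (S : nat -> nat -> R) (theta r j : nat) : R :=
  covrec (fun m f =>
    if (m < theta)%N then (m == j)%:R
    else - (S m (m - theta)%N)^-1 *
         \sum_(m - theta <= l < m) f l * S l (m - theta)%N) r.

Lemma psi_lt (R : realType) (alpha : R) (S : nat -> nat -> R) (theta r : nat) (t : R) :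
  (r < theta)%N -> psi alpha S theta r t = 0.
Proof. by rewrite /psi /covrec => ->. Qed.

Lemma psi_addn (R : realType) (alpha : R) (S : nat -> nat -> R) (theta r : nat) (t : R) :
  psi alpha S theta (r + theta) t =
  (S (r + theta)%N r)^-1 *
    (t `^ (r%:R * alpha) - \sum_(r <= l < r + theta) S l r * psi alpha S theta l t).
Proof.
rewrite {1}/psi covrecE; first by rewrite ltnNge leq_addl /= addnK.
move=> f f' ff'; case: ifP => // _; congr (_ * (_ - _)).
by apply: eq_big_nat => l /andP[_ lm]; rewrite ff'.
Qed.

Lemma dcoef_lt (R : realType) (S : nat -> nat -> R) (theta r j : nat) :
  (r < theta)%N -> dcoef S theta r j = (r == j)%:R.
Proof. by rewrite /dcoef /covrec => ->. Qed.

Lemma dcoef_addn (R : realType) (S : nat -> nat -> R) (theta r j : nat) :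
  dcoef S theta (r + theta) j =
  - (S (r + theta)%N r)^-1 * \sum_(r <= l < r + theta) dcoef S theta l j * S l r.
Proof.
rewrite {1}/dcoef covrecE; first by rewrite ltnNge leq_addl /= addnK.
move=> f f' ff'; case: ifP => // _; congr (_ * _).
by apply: eq_big_nat => l /andP[_ lm]; rewrite ff'.
Qed.

Definition legC (R : realType) (i j : nat) : R :=
  (-1) ^+ (i + j) * (i + j)`!%:R / ((i - j)`!%:R * j`!%:R ^+ 2).

Definition legP (R : realType) (alpha : R) (i : nat) (t : R) : R :=
  \sum_(j < i.+1) legC R i j * t `^ (j%:R * alpha).

Definition Hpert (R : realType) (alpha : R) (n theta : nat) (tau : 'cV[R]_theta) (t : R) : R :=
  \sum_(r < theta) tau r 0 * legP alpha (n + theta - r) t.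

(* y in span{1, ..., t^(n alpha)} and tau solve the perturbed problem.  The
   equation, an identity between fractional polynomials, is imposed at t > 0,
   where the kernel t^(-beta) (t - s)^(gamma - 1) s^(beta - gamma) makes sense. *)
Definition tau_solution (R : realType) (gamma beta alpha : R) (n : nat)
    (g : 'I_n.+1 -> R) (h : 'M[R]_n.+1) (theta : nat)
    (y : R -> R) (tau : 'cV[R]_theta) : Prop :=
  fracpoly_span alpha n y /\
  forall t : R, 0 < t ->
    Lop gamma beta alpha h y t = gtilde alpha g t + Hpert alpha n tau t.

Definition tau_matrix (R : realType) (n theta : nat) (d : nat -> nat -> R) : 'M[R]_theta :=
  \matrix_(l < theta, r < theta)
     \sum_(j < (n + theta - r).+1) legC R (n + theta - r) j * d j l.

Definition tau_rhs (R : realType) (n theta : nat) (g : 'I_n.+1 -> R)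
    (d : nat -> nat -> R) : 'cV[R]_theta :=
  \col_(l < theta) (- \sum_(r < n.+1) g r * d r l).

(* Main.v *)
From HB Require Import structures.
Require Import Defs.
From mathcomp Require Import all_boot all_order all_algebra.
From mathcomp Require Import all_classical all_reals all_analysis.
From mathcomp Require Import measurable_realfun ring lra.

(** A fractional polynomial is p(t^alpha) for an ordinary polynomial p, and p is
    determined by its values at t > 0 ([poly_powR_inj]). Euler's integral
    ([abel_kernel]) shows that, in the variable u = t^alpha, the integral operator L
    sends u^r to the sum of S_(l,r) u^l over r <= l <= r + theta ([Lop_poly]). The
    theorem is then a statement about a banded linear operator on polynomials with
    nonvanishing top band S_(r+theta,r).

    The recursions for psi_r and d_(r,j) say exactly that
      L psi_r = u^r - sum_(j < theta) d_(r,j) u^j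
    and that psi_r has degree at most r - theta ([psi_poly]). Let Y be the candidate
    solution, a combination of the psi_r, and let rhs be the same combination of the
    u^r, that is, the right-hand side of the perturbed problem ([tau_comb]). Then
    L Y = rhs - D, where D has degree below theta and its coefficients are the entries
    of M tau - B ([tau_comb_defect_coef]). If M tau = B, then L Y = rhs, and the degree
    bound puts Y into the span of 1, ..., t^(n alpha).

    Conversely, because of the top band L raises the degree of every nonzero
    polynomial by theta, so its image contains no nonzero polynomial of degree below
    theta ([band_op_small_eq0]). If L y = rhs, then L (y - Y) = D forces y = Y, and
    hence D = 0, which is M tau = B. *)

Set Implicit Arguments.
Unset Strict Implicit.
Unset Printing Implicit Defensive.

Import Order.TTheory GRing.Theory Num.Theory.
Import numFieldNormedType.Exports.

Local Open Scope classical_set_scope.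
Local Open Scope ring_scope.

(** * The Euler integral with a weakly singular kernel *)

Lemma continuous_powR (R : realType) (a x : R) : 0 < x ->
  {for x, continuous (fun y : R => y `^ a)}.
Proof.
move=> x0; apply/differentiable_continuous/derivable1_diffP.
exact: (@ex_derive _ _ _ _ _ _ _ (is_derive1_powR a x0)).
Qed.

Lemma integral_powR (R : realType) (a e : R) : 0 < a -> 0 < e -> e < 1 ->
  (\int[lebesgue_measure]_(x in `[e, 1%R]) (x `^ (a - 1))%:E =
   ((1 - e `^ a) / a)%:E)%E.
Proof.
move=> a0 e0 e1.
have a_neq0 : a != 0 by rewrite gt_eqF.
have cF (x : R) : 0 < x -> {for x, continuous (fun x : R => a^-1 * x `^ a)}.
  by move=> x0; apply: continuousM; [exact: cvg_cst|exact: continuous_powR].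
have dF (x : R) : 0 < x -> is_derive x 1 (fun x : R => a^-1 * x `^ a) (x `^ (a - 1)).
  move=> x0; have := is_deriveZ a^-1 (is_derive1_powR a x0).
  by rewrite /GRing.scale /= mulKf.
rewrite (@continuous_FTC2 _ _ (fun x : R => a^-1 * x `^ a))//.
- by rewrite -EFinB powR1 -mulrBr mulrC.
- apply: continuous_in_subspaceT => x; rewrite inE/= in_itv/= => /andP[ex _].
  by apply: continuous_powR; rewrite (lt_le_trans e0).
- split => [x||]; first by rewrite in_itv/= => /andP[/(lt_trans e0)/dF[]].
  + by apply: cvg_at_right_filter; exact: cF.
  + by apply: cvg_at_left_filter; exact: cF.
- move=> x; rewrite in_itv/= => /andP[/(lt_trans e0) x0 _].
  by rewrite derive1E; have [] := dF x x0.
Qed.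

(** The integrand is singular at 0 when a < 1, so the integral is exhausted by the
    intervals [1/(n+1), 1], on which the fundamental theorem of calculus gives at
    most 1/a; monotone convergence passes the bound to the limit. *)
Lemma integrable_powR01 (R : realType) (a : R) : 0 < a ->
  lebesgue_measure.-integrable `[0, 1] (EFin \o (fun x : R => x `^ (a - 1))).
Proof.
move=> a0; apply/integrableP; split.
  by apply/measurable_EFinP; apply: measurable_funTS; exact: measurable_powR.
under eq_integral do rewrite /= ger0_norm ?powR_ge0//.
rewrite -integral_itv_obnd_cbnd; last first.
  by apply/measurable_EFinP; apply: measurable_funTS; exact: measurable_powR.
rewrite itv_open_bnd_bigcup.
have nd : nondecreasing_seq (fun n : nat => `[0 + n.+1%:R^-1 : R, 1]%classic).
  move=> m n mn; rewrite subsetEset; apply: subset_itvr.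
  by rewrite bnd_simp !add0r lef_pV2 ?posrE// ler_nat.
have cvgI : (\int[lebesgue_measure]_(x in `[(0 + n.+1%:R^-1 : R)%R, 1%R])
      (x `^ (a - 1))%:E)%E @[n --> \oo] -->
    (\int[lebesgue_measure]_(x in \bigcup_n `[(0 + n.+1%:R^-1 : R)%R, 1%R]%classic)
      (x `^ (a - 1))%:E)%E.
  apply: ge0_nondecreasing_set_cvg_integral => //.
  - by move=> n; apply/measurable_EFinP; apply: measurable_funTS; exact: measurable_powR.
  - by move=> n x _; rewrite lee_fin powR_ge0.
rewrite -(cvg_lim _ cvgI)//.
apply: (@le_lt_trans _ _ (a^-1)%:E); last exact: ltry.
apply: lime_le; first by apply/cvg_ex; eexists; exact: cvgI.
(* For n = 0 the interval [1/(n+1), 1] is a point. *)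
apply: nearW => -[|n].
  by rewrite add0r invr1 set_itv1 integral_set1 lee_fin invr_ge0 ltW.
rewrite add0r integral_powR//; last by rewrite invf_lt1// ltr1n.
by rewrite lee_fin ler_pdivrMr// mulVf ?gt_eqF// lerBlDr lerDl powR_ge0.
Qed.

Lemma measurable_powR_subl (R : realType) (c a : R) :
  measurable_fun setT (fun x : R => (c - x) `^ a).
Proof.
apply: (measurableT_comp (@measurable_powR _ a)).
by apply: measurable_funB => //; exact: measurable_cst.
Qed.

(** Since 0 <= b the factor (1 - x)^b is at most 1, so only the singularity of
    x^(a - 1) at 0 matters. *)
Lemma integrable_beta (R : realType) (a b : R) : 0 < a -> 0 <= b ->
  lebesgue_measure.-integrable `[0, 1]
    (EFin \o (fun x : R => x `^ (a - 1) * (1 - x) `^ b)).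
Proof.
move=> a0 b0; apply: (le_integrable _ _ _ (integrable_powR01 a0)) => //.
  apply/measurable_EFinP; apply: measurable_funTS.
  apply: measurable_funM; first exact: measurable_powR.
  exact: measurable_powR_subl.
move=> x /=; rewrite in_itv/= => /andP[x0 x1].
rewrite lee_fin !ger0_norm ?mulr_ge0 ?powR_ge0//.
rewrite ler_piMr ?powR_ge0// -[leRHS](congr1 (fun f => f b) (powR1 R)).
by rewrite ge0_ler_powR ?nnegrE ?subr_ge0// lerBlDr lerDl.
Qed.

Lemma measurable_reflect (R : realType) (t : R) :
  measurable_fun setT (fun s : measurableTypeR R => 1 - s / t : measurableTypeR R).
Proof.
apply: measurable_funB; first exact: measurable_cst.
by apply: measurable_funM => //; exact: measurable_cst.
Qed.

(** The change of variable x = 1 - s/t is done at the level of measures, since the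
    integrand is singular at an end of the interval, where substitution theorems for
    continuous integrands fail to apply. Uniqueness of Lebesgue measure reduces
    the identity to half-open intervals. *)
Lemma lebesgue_measure_reflect (R : realType) (t : R) : 0 < t ->
  forall A : set R, measurable A ->
  pushforward lebesgue_measure
    (fun s : R => 1 - s / t : measurableTypeR R) A =
  (t%:E * lebesgue_measure A)%E.
Proof.
move=> t0 A mA.
pose phi (s : measurableTypeR R) : measurableTypeR R := 1 - s / t.
have mphi : measurable_fun setT phi by exact: measurable_reflect.
have ti : 0 <= t^-1 by rewrite invr_ge0 ltW.
have mE : lebesgue_measure A = (t^-1%:E * pushforward lebesgue_measure phi A)%E.
  apply: (@lebesgue_measure_unique R
    (mscale (NngNum ti) (pushforward lebesgue_measure phi))) => //= _ [[x y]] _ <- /=.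
  rewrite /mscale/= /pushforward.
  have -> : phi @^-1` `]x, y] = `[(1 - y) * t, (1 - x) * t[%classic.
    apply/seteqP; split => s /=; rewrite !in_itv/= /phi.
      by rewrite -ler_pdivlMr// -ltr_pdivrMr//; move=> /andP[? ?]; apply/andP; split; lra.
    by rewrite -ler_pdivlMr// -ltr_pdivrMr//; move=> /andP[? ?]; apply/andP; split; lra.
  rewrite !lebesgue_measure_itv/= !lte_fin ltr_pM2r// ltrD2l ltrN2.
  case: ifPn => _; last by rewrite mule0.
  by rewrite -!EFinB -EFinM; congr EFin; field; rewrite gt_eqF.
by rewrite mE muleA -EFinM mulfV ?gt_eqF// mul1e.
Qed.

Lemma ge0_integral_reflect (R : realType) (t : R) (f : R -> \bar R) : 0 < t ->
  measurable_fun setT f -> (forall x, 0 <= f x)%E ->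
  (\int[lebesgue_measure]_(s in `[0%R, t]) f (1 - s / t)%R =
   t%:E * \int[lebesgue_measure]_(x in `[0%R, 1%R]) f x)%E.
Proof.
move=> t0 mf f0.
pose phi (s : measurableTypeR R) : measurableTypeR R := 1 - s / t.
have mphi : measurable_fun setT phi by exact: measurable_reflect.
have t0' : 0 <= t by rewrite ltW.
have -> : `[0, t]%classic = phi @^-1` `[0, 1].
  apply/seteqP; split => s /=; rewrite !in_itv/= /phi lerBrDr add0r lerBlDr lerDl.
    by move=> /andP[s0 st]; rewrite divr_ge0// ler_pdivrMr// mul1r st.
  by rewrite ler_pdivrMr// mul1r => /andP[->]; rewrite ler_pdivlMr// mul0r => ->.
rewrite -(@ge0_integral_pushforward _ _ _ _ _ phi mphi)//; last exact: measurable_funTS.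
rewrite -(@ge0_integral_mscale _ _ _ lebesgue_measure _ _ (NngNum t0'))//; last first.
  exact: measurable_funTS.
by apply: eq_measure_integral => A mA _; exact: lebesgue_measure_reflect.
Qed.

Lemma abel_kernelE (R : realType) (a b t s : R) : 0 < t -> 0 <= s <= t ->
  (t - s) `^ (a - 1) * s `^ b =
  t `^ (a - 1 + b) * ((1 - s / t) `^ (a - 1) * (1 - (1 - s / t)) `^ b).
Proof.
move=> t0 /andP[s0 st].
have -> : 1 - (1 - s / t) = s / t by ring.
have st1 : 0 <= 1 - s / t by rewrite subr_ge0 ler_pdivrMr// mul1r.
have s1 : 0 <= s / t by rewrite divr_ge0// ltW.
rewrite [t `^ _]powRD ?(gt_eqF t0) ?implybT// mulrACA -!powRM// ?(ltW t0)//.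
congr (_ `^ _ * _ `^ _); first by field; rewrite gt_eqF.
by field; rewrite gt_eqF.
Qed.

(** Euler's evaluation of the integral of (t - s)^(a - 1) s^b over [0, t]. The
    substitution x = 1 - s/t sends the singularity at s = t to x = 0, which matches
    the order of the two arguments of [Beta]. Integrability comes with the value
    since linearity of the real-valued integral needs it. *)
Lemma abel_kernel (R : realType) (a b t : R) : 0 < a -> 0 <= b -> 0 < t ->
  lebesgue_measure.-integrable `[0, t]
    (EFin \o (fun s : R => (t - s) `^ (a - 1) * s `^ b)) /\
  \int[lebesgue_measure]_(s in `[0, t]) ((t - s) `^ (a - 1) * s `^ b) =
  t `^ (a + b) * Beta a (b + 1).
Proof.
move=> a0 b0 t0.
pose f (x : R) := t `^ (a - 1 + b) * (x `^ (a - 1) * (1 - x) `^ b).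
have mf : measurable_fun setT (EFin \o f).
  apply/measurable_EFinP; apply: measurable_funM; first exact: measurable_cst.
  apply: measurable_funM; first exact: measurable_powR.
  exact: measurable_powR_subl.
have f0 x : (0 <= (EFin \o f) x)%E by rewrite lee_fin !mulr_ge0 ?powR_ge0.
have intf : lebesgue_measure.-integrable `[0, 1] (EFin \o f).
  have := integrableZl _ (t `^ (a - 1 + b)) (integrable_beta a0 b0).
  by apply => //.
have fE : (\int[lebesgue_measure]_(s in `[0%R, t])
    ((t - s) `^ (a - 1) * s `^ b)%:E =
    (t `^ (a + b) * Beta a (b + 1))%:E)%E.
  transitivity (\int[lebesgue_measure]_(s in `[0%R, t])
      (EFin \o f) (1 - s / t)%R)%E.
    apply: eq_integral => s; rewrite inE/= in_itv/= => st.
    by rewrite (abel_kernelE a b t0 st).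
  rewrite (ge0_integral_reflect t0 mf f0).
  rewrite -(fineK (integrable_fin_num _ intf))// -EFinM; congr EFin.
  rewrite -/(Rintegral _ _ _) RintegralZl//; last exact: integrable_beta.
  rewrite /Beta addrK mulrA; congr (_ * _).
  by rewrite -[X in X * _](powRr1 (ltW t0)) -powRD ?(gt_eqF t0) ?implybT//;
    congr (_ `^ _); ring.
split; last by rewrite /Rintegral fE.
apply/integrableP; split.
  apply/measurable_EFinP; apply: measurable_funTS.
  apply: measurable_funM; last exact: measurable_powR.
  exact: measurable_powR_subl.
under eq_integral do rewrite /= ger0_norm ?mulr_ge0 ?powR_ge0//.
by rewrite fE ltry.
Qed.

(** * Banded operators on polynomials and their FC-polynomials *)

Lemma powR_fracE (R : realType) (alpha t : R) (i : nat) :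
  t `^ (i%:R * alpha) = (t `^ alpha) ^+ i.
Proof. by rewrite mulrC powRrM powR_mulrn// powR_ge0. Qed.

(** The image of X^r under the operator with matrix S; the truncation makes the r-th
    column a polynomial, and loses nothing when S vanishes below row r + theta. *)
Definition band_col (R : realType) (S : nat -> nat -> R) (theta r : nat) : {poly R} :=
  \poly_(l < (r + theta).+1) S l r.

Definition band_op (R : realType) (S : nat -> nat -> R) (theta : nat)
    (p : {poly R}) : {poly R} :=
  \sum_(r < size p) p`_r *: band_col S theta r.

Section BandedOperator.
Variables (R : realType) (S : nat -> nat -> R) (theta : nat).
Local Notation band_op := (band_op S theta).
Local Notation band_col := (band_col S theta).

Lemma band_op_widen (p : {poly R}) (N : nat) : (size p <= N)%N ->
  band_op p = \sum_(r < N) p`_r *: band_col r.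
Proof.
move=> pN; rewrite /band_op (big_ord_widen N (fun r => p`_r *: band_col r) pN).
rewrite big_mkcond; apply: eq_bigr => r _.
by case: ltnP => // /(nth_default 0) ->; rewrite scale0r.
Qed.

Lemma band_op_is_linear : linear band_op.
Proof.
move=> a p q; pose N := maxn (size (a *: p + q)) (maxn (size p) (size q)).
rewrite !(@band_op_widen _ N) ?leq_max ?leqnn ?orbT//.
rewrite scaler_sumr -big_split; apply: eq_bigr => r _ /=.
by rewrite coefD coefZ scalerDl scalerA.
Qed.
HB.instance Definition _ :=
  GRing.isLinear.Build R {poly R} {poly R} _ band_op band_op_is_linear.

Lemma band_op0 : band_op 0 = 0.
Proof. exact: linear0. Qed.

Lemma band_opZ a p : band_op (a *: p) = a *: band_op p.
Proof. exact: linearZ. Qed.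

Lemma band_opD p q : band_op (p + q) = band_op p + band_op q.
Proof. exact: linearD. Qed.

Lemma band_opB p q : band_op (p - q) = band_op p - band_op q.
Proof. exact: linearB. Qed.

Lemma band_op_sum (I : Type) (s : seq I) (Q : pred I) (F : I -> {poly R}) :
  band_op (\sum_(i <- s | Q i) F i) = \sum_(i <- s | Q i) band_op (F i).
Proof. exact: linear_sum. Qed.

Lemma band_op_Xn (r : nat) : band_op 'X^r = band_col r.
Proof.
rewrite /band_op size_polyXn big_ord_recr/= coefXn eqxx scale1r big1 ?add0r// => i _.
by rewrite coefXn ltn_eqF ?scale0r// ltn_ord.
Qed.

Hypothesis S_low : forall l r : nat, (l < r)%N -> S l r = 0.
Hypothesis S_top : forall r : nat, S (r + theta)%N r != 0.

Lemma band_colE (r : nat) :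
  band_col r =
  \sum_(r <= l < r + theta) S l r *: 'X^l + S (r + theta)%N r *: 'X^(r + theta).
Proof.
rewrite /band_col poly_def -(big_mkord xpredT (fun l => S l r *: 'X^l)) big_nat_recr//=.
congr (_ + _); rewrite (big_cat_nat (n := r))//= ?leq_addr//.
by rewrite big_nat big1 ?add0r// => l /andP[_ lr]; rewrite S_low ?scale0r.
Qed.

Lemma band_op_coef_top (p : {poly R}) :
  (band_op p)`_((size p).-1 + theta) =
  lead_coef p * S ((size p).-1 + theta)%N (size p).-1.
Proof.
have [->|p0] := eqVneq p 0; first by rewrite band_op0 coef0 lead_coef0 mul0r.
have : (0 < size p)%N by rewrite size_poly_gt0.
rewrite lead_coefE /band_op; case: (size p) => // k _ /=.
rewrite coef_sum big_ord_recr/= big1 ?add0r.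
  by rewrite coefZ coef_poly ltnS leqnn.
move=> i _; rewrite coefZ coef_poly ltnS leq_add2r leqNgt ltn_ord/=.
by rewrite mulr0.
Qed.

(** The leading coefficient c of a nonzero p yields the coefficient
    c S_(d+theta, d) <> 0 of X^(d+theta), d = deg p, in the image, so every nonzero
    element of the image has degree at least theta. *)
Lemma band_op_small_eq0 (p : {poly R}) : (size (band_op p) <= theta)%N -> p = 0.
Proof.
move=> sp; apply/eqP; rewrite -lead_coef_eq0.
have := band_op_coef_top p.
rewrite nth_default; last by rewrite (leq_trans sp)// leq_addl.
by move/esym/eqP; rewrite mulf_eq0 (negbTE (S_top _)) orbF.
Qed.

(** The defining property of the FC-polynomials: psi_r is a preimage of X^r up to
    the defect sum_j d_(r,j) X^j in degrees below theta. It holds for r < theta since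
    both sides vanish. Solving the image of X^r for its top monomial X^(r+theta)
    propagates it, and the recursion of d is that of the defects. The degree bound
    is what makes the Tau-solution lie in the prescribed span. *)
Lemma psi_poly (alpha : R) : exists P : nat -> {poly R}, forall r,
  [/\ (size (P r) <= r.+1 - theta)%N,
      forall t, psi alpha S theta r t = (P r).[t `^ alpha]
    & band_op (P r) = 'X^r - \sum_(j < theta) dcoef S theta r j *: 'X^j].
Proof.
pose good r (p : {poly R}) := [/\ (size p <= r.+1 - theta)%N,
      forall t, psi alpha S theta r t = p.[t `^ alpha]
    & band_op p = 'X^r - \sum_(j < theta) dcoef S theta r j *: 'X^j].
suff H m : exists P : nat -> {poly R}, forall r, (r < m)%N -> good r (P r).
  have /choice[P PP] r : exists p, good r p.
    by have [P /(_ r (leqnn _))] := H r.+1; exists (P r).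
  by exists P.
elim: m => [|m [P IH]]; first by exists (fun=> 0).
suff [p pP] : exists p, good m p.
  exists (fun r => if r == m then p else P r) => r.
  by rewrite ltnS leq_eqVlt; case: eqP => [-> _|_ /= /IH].
have [mt|] := ltnP m theta.
  exists 0; split; [by rewrite size_poly0|by move=> t; rewrite psi_lt ?horner0|].
  rewrite band_op0 (bigD1 (Ordinal mt))//= dcoef_lt// eqxx scale1r big1 ?addr0 ?subrr//.
  move=> j jm; rewrite dcoef_lt// (_ : m == j = false) ?scale0r//.
  by apply/negbTE; apply: contraNN jm => /eqP mj; apply/eqP/val_inj.
move=> tm; have -> : m = (m - theta + theta)%N by rewrite subnK.
(* From here on m = r + theta, the form in which both recursions are stated. *)
have : forall l, (l < m - theta + theta)%N -> good l (P l) by rewrite subnK.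
move: (m - theta)%N => {m tm IH} r IH.
pose c := S (r + theta)%N r.
exists (c^-1 *: ('X^r - \sum_(r <= l < r + theta) S l r *: P l)); split.
- apply: (leq_trans (size_scale_leq _ _)).
  rewrite -addSn addnK; apply: (leq_trans (size_polyD _ _)).
  rewrite geq_max size_polyXn leqnn size_polyN big_nat.
  apply: (big_ind (fun p : {poly R} => size p <= r.+1)%N); first by rewrite size_poly0.
    by move=> p q pr qr; rewrite (leq_trans (size_polyD _ _))// geq_max pr.
  move=> l /andP[rl lr]; apply: (leq_trans (size_scale_leq _ _)).
  have [sl _ _] := IH l lr; apply: (leq_trans sl).
  by rewrite leq_subLR addnC addSn ltnW.
- move=> t; rewrite psi_addn hornerZ hornerD hornerN hornerXn powR_fracE.
  congr (_ * (_ - _)); rewrite horner_sum !big_nat; apply: eq_bigr => l /andP[_ lr].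
  by rewrite hornerZ; have [_ -> _] := IH l lr.
- rewrite band_opZ band_opB band_op_Xn band_colE band_op_sum.
  rewrite [X in _ *: (_ - X)](_ : _ =
      \sum_(r <= l < r + theta) S l r *: 'X^l
      - \sum_(r <= l < r + theta)
          S l r *: \sum_(j < theta) dcoef S theta l j *: 'X^j); last first.
    rewrite -sumrB !big_nat; apply: eq_bigr => l /andP[_ lr].
    by have [_ _ Pl] := IH l lr; rewrite band_opZ Pl scalerBr.
  rewrite opprB [_ + S _ _ *: _]addrC -addrA [_ + (_ - _)]addrC subrK.
  rewrite scalerDr scalerA mulVf ?S_top// scale1r addrC.
  rewrite [RHS]addrC; congr (_ + _); rewrite -sumrN scaler_sumr.
  under eq_bigr do rewrite scaler_sumr scaler_sumr.
  rewrite exchange_big; apply: eq_bigr => j _ /=.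
  rewrite dcoef_addn mulNr scaleNr opprK -scaler_sumr -scalerA; congr (_ *: _).
  by rewrite scaler_suml; apply: eq_bigr => l _; rewrite scalerA mulrC.
Qed.

End BandedOperator.

(** * The integral operator in the variable t^alpha *)

(** With the convention 0^0 = 1 the identity survives s = 0 for nonnegative exponents. *)
Lemma powRD_ge0 (R : realType) (s x y : R) : 0 <= x -> 0 <= y ->
  s `^ (x + y) = s `^ x * s `^ y.
Proof.
rewrite [0 <= x]le_eqVlt => /predU1P[<- _|x0 y0].
  by rewrite add0r powRr0 mul1r.
by rewrite powRD// gt_eqF// ltr_wpDr.
Qed.

Lemma Scoef_low (R : realType) (alpha : R) (sigma1 sigma2 n : nat)
    (h : 'M[R]_n.+1) (l r : nat) :
  (l < r)%N -> Scoef alpha sigma1 sigma2 h l r = 0.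
Proof.
move=> lr; rewrite /Scoef ltn_eqF// big1 ?subr0// => i _.
by rewrite big_pred0// => j; rewrite gtn_eqF// (leq_trans lr)// -addnA leq_addr.
Qed.

(** All coefficients of the right-hand side outside the rows r, ..., r + theta
    vanish, above by the definition of the height and below trivially, so truncating
    to these rows loses nothing. *)
Lemma band_col_Scoef (R : realType) (alpha : R) (sigma1 sigma2 n theta : nat)
    (h : 'M[R]_n.+1)
    (S := Scoef alpha sigma1 sigma2 h) (r : nat) :
  is_height n S theta ->
  band_col S theta r = 'X^r - \sum_(i < n.+1) \sum_(j < n.+1)
    (h i j * Beta (sigma1%:R * alpha)
       ((r%:R + j%:R + sigma2%:R - sigma1%:R) * alpha + 1)) *: 'X^(r + i + j).
Proof.
move=> [_ S_high _]; apply/polyP => k.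
transitivity (S k r); first by rewrite coef_poly; case: ltnP => // /S_high ->.
rewrite coefB coefXn coef_sum; congr (_ - _).
apply: eq_bigr => i _; rewrite coef_sum big_mkcond; apply: eq_bigr => j _.
by rewrite coefZ coefXn eq_sym; case: eqVneq; rewrite ?mulr1 ?mulr0.
Qed.

(** Integrability is recorded with the value so that finite linear combinations can
    be integrated termwise. *)
Definition has_Rint (R : realType) (t : R) (f : R -> R) (v : R) : Prop :=
  lebesgue_measure.-integrable `[0, t] (EFin \o f) /\
  \int[lebesgue_measure]_(s in `[0, t]) f s = v.

Lemma has_RintZ (R : realType) (t : R) (f : R -> R) (v a : R) :
  has_Rint t f v -> has_Rint t (fun s => a * f s) (a * v).
Proof.
move=> [fi fv]; split; last by rewrite RintegralZl// fv.
have := integrableZl _ a fi; exact.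
Qed.

Lemma has_Rint_sum (R : realType) (t : R) (I : Type) (r : seq I)
    (f : I -> R -> R) (v : I -> R) :
  (forall i, has_Rint t (f i) (v i)) ->
  has_Rint t (fun s => \sum_(i <- r) f i s) (\sum_(i <- r) v i).
Proof.
move=> fv; elim: r => [|i r [IHi IHv]].
  split; last by rewrite big_nil;
    under eq_Rintegral do rewrite big_nil; rewrite Rintegral_cst// mul0r.
  rewrite (_ : EFin \o _ = cst 0%E); first exact: integrable0.
  by apply/funext => s /=; rewrite big_nil.
have [fi vi] := fv i.
have -> : (fun s => \sum_(k <- i :: r) f k s) =
    (fun s => f i s + \sum_(k <- r) f k s).
  by apply/funext => s; rewrite big_cons.
split; last by rewrite big_cons RintegralD// vi IHv.
have := integrableD _ fi IHi; exact.
Qed.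

(** In the variable u = t^alpha the integral operator is the banded operator on
    polynomials: termwise, the kernel integrates t^(i alpha) s^((r + j) alpha) to a Beta
    value times t^((r + i + j) alpha), the factor t^(-beta) exactly compensating the
    exponent gamma + (beta - gamma). *)
Lemma Lop_poly (R : realType) (alpha : R) (sigma1 sigma2 n theta : nat)
    (h : 'M[R]_n.+1)
    (S := Scoef alpha sigma1 sigma2 h) (y : R -> R) (p : {poly R}) (t : R) :
  is_height n S theta -> 0 < alpha -> (0 < sigma1)%N -> (sigma1 <= sigma2)%N ->
  (forall s : R, 0 <= s -> y s = p.[s `^ alpha]) -> 0 < t ->
  Lop (sigma1%:R * alpha) (sigma2%:R * alpha) alpha h y t =
  (band_op S theta p).[t `^ alpha].
Proof.
move=> hS a0 s1 s12 yE t0; set u := t `^ alpha.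
pose b (r j : nat) : R := (r%:R + j%:R + sigma2%:R - sigma1%:R) * alpha.
have b_ge0 r j : 0 <= b r j.
  apply: mulr_ge0; last exact: ltW.
  by rewrite subr_ge0 -!natrD ler_nat (leq_trans s12)// leq_addl.
pose B r j := Beta (sigma1%:R * alpha) (b r j + 1).
have g0 : 0 < sigma1%:R * alpha by rewrite mulr_gt0// ltr0n.
have ker r j := abel_kernel g0 (b_ge0 r j) t0.
have c0 : 0 <= sigma2%:R * alpha - sigma1%:R * alpha.
  by rewrite subr_ge0 ler_wpM2r ?(ltW a0)// ler_nat.
(* The integrand of Lop, expanded over the monomials of p and of Htilde. *)
have main : has_Rint t
    (fun s => \sum_(r < size p) \sum_(i < n.+1) \sum_(j < n.+1)
       (p`_r * h i j * t `^ (- (sigma2%:R * alpha)) * u ^+ i) *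
       ((t - s) `^ (sigma1%:R * alpha - 1) * s `^ (b r j)))
    (\sum_(r < size p) \sum_(i < n.+1) \sum_(j < n.+1)
       (p`_r * h i j * t `^ (- (sigma2%:R * alpha)) * u ^+ i) *
       (t `^ (sigma1%:R * alpha + b r j) * B r j)).
  apply: has_Rint_sum => r; apply: has_Rint_sum => i; apply: has_Rint_sum => j.
  exact: has_RintZ.
rewrite /Lop yE; last exact: ltW.
rewrite -/u.
transitivity (p.[u] - \sum_(r < size p) \sum_(i < n.+1) \sum_(j < n.+1)
       (p`_r * h i j * t `^ (- (sigma2%:R * alpha)) * u ^+ i) *
       (t `^ (sigma1%:R * alpha + b r j) * B r j)).
  congr (_ - _); have [_ <-] := main.
  apply: eq_Rintegral => s; rewrite inE/= in_itv/= => /andP[s0 st].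
  rewrite yE// horner_coef /Htilde mulr_sumr; apply: eq_bigr => r _.
  rewrite mulr_sumr mulr_suml; apply: eq_bigr => i _.
  rewrite mulr_sumr mulr_suml; apply: eq_bigr => j _.
  have -> : s `^ b r j =
      s `^ (sigma2%:R * alpha - sigma1%:R * alpha) *
      s `^ (j%:R * alpha) * s `^ (r%:R * alpha).
    rewrite -!powRD_ge0 ?(addr_ge0 c0) ?mulr_ge0 ?(ltW a0)//.
    by rewrite /b; congr (_ `^ _); ring.
  by rewrite !powR_fracE -/u; ring.
rewrite /band_op horner_sum horner_coef -sumrB; apply: eq_bigr => r _.
rewrite hornerZ (band_col_Scoef r hS) hornerD hornerN hornerXn mulrBr; congr (_ - _).
rewrite horner_sum mulr_sumr; apply: eq_bigr => i _.
rewrite horner_sum mulr_sumr; apply: eq_bigr => j _.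
rewrite hornerZ hornerXn -/(b r j) -/(B r j).
have -> : u ^+ (r + i + j) =
    t `^ (- (sigma2%:R * alpha)) * u ^+ i * t `^ (sigma1%:R * alpha + b r j).
  rewrite /u -!powR_fracE -!powRD ?(gt_eqF t0) ?implybT//.
  by congr (_ `^ _); rewrite /b !natrD; ring.
by ring.
Qed.

(** t^alpha takes the values 1, 2, 3, ..., which are too many roots for a nonzero
    polynomial. *)
Lemma poly_powR_inj (R : realType) (alpha : R) (p q : {poly R}) : alpha != 0 ->
  (forall t : R, 0 < t -> p.[t `^ alpha] = q.[t `^ alpha]) -> p = q.
Proof.
move=> a0 pq; apply/eqP; rewrite -subr_eq0; apply/negPn/negP => pq0.
pose rs := [seq k.+1%:R : R | k <- iota 0 (size (p - q))].
suff: (size rs < size (p - q)%R)%N by rewrite size_map size_iota ltnn.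
apply: max_poly_roots => //.
- apply/allP => _ /mapP[k _ ->].
  have k0 : 0 < k.+1%:R :> R by [].
  have -> : k.+1%:R = (k.+1%:R `^ alpha^-1) `^ alpha :> R.
    by rewrite -powRrM mulVf// powRr1// ltW.
  by rewrite /root hornerD hornerN pq ?subrr// powR_gt0.
- rewrite map_inj_uniq ?iota_uniq// => i j /eqP.
  by rewrite eqr_nat => /eqP[].
Qed.

Lemma fracpoly_spanP (R : realType) (alpha : R) (n : nat) (y : R -> R) :
  fracpoly_span alpha n y <->
  exists2 p : {poly R}, (size p <= n.+1)%N & forall t, 0 <= t -> y t = p.[t `^ alpha].
Proof.
split=> [[c yE]|[p sp yE]].
  exists (\poly_(i < n.+1) (if insub i is Some j then c j else 0)).
    exact: size_poly.
  move=> t t0; rewrite yE// horner_poly; apply: eq_bigr => i _.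
  by rewrite insubT ?ltn_ord// => ?; rewrite powR_fracE; congr (c _ * _); apply: val_inj.
exists (fun i => p`_i) => t t0; rewrite yE// (horner_coef_wide _ sp).
by apply: eq_bigr => i _; rewrite powR_fracE.
Qed.

Lemma lcm_exponentE (R : realType) (p q m : nat) : (0 < q)%N -> (0 < m)%N -> (q %| m)%N ->
  (p * m %/ q)%N%:R * m%:R^-1 = p%:R / q%:R :> R.
Proof.
move=> q0 m0 qm; rewrite -muln_divA// natrM natf_div// -mulrA; congr (_ * _).
by rewrite mulrAC mulfV ?mul1r// pnatr_eq0 -lt0n.
Qed.

(** * The Tau method for a banded operator *)

Section TauMethod.
Variables (R : realType) (n theta : nat) (S : nat -> nat -> R).
Variables (g : 'I_n.+1 -> R) (tau : 'cV[R]_theta) (P : nat -> {poly R}).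
Local Notation d := (dcoef S theta).
Local Notation band_op := (band_op S theta).

Hypothesis P_op : forall r, band_op (P r) = 'X^r - \sum_(j < theta) d r j *: 'X^j.

(** The right-hand side of the perturbed problem, the candidate solution and its
    defect are the same linear combination of the monomials, of the FC-polynomials
    and of the defects sum_j d_(r,j) X^j, respectively. *)
Definition tau_comb (E : nat -> {poly R}) : {poly R} :=
  \sum_(r < n.+1) g r *: E r +
  \sum_(r < theta) tau r ord0 *:
    (\sum_(j < (n + theta - r).+1) legC R (n + theta - r) j *: E j).

Lemma size_tau_comb (E : nat -> {poly R}) (N : nat) :
  (forall r, r <= n + theta -> size (E r) <= N)%N -> (size (tau_comb E) <= N)%N.
Proof.
move=> EN; rewrite /tau_comb.
have sum_le (m : nat) (F : 'I_m -> {poly R}) (c : 'I_m -> R) :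
    (forall i, size (F i) <= N)%N -> (size (\sum_(i < m) c i *: F i)%R <= N)%N.
  move=> FN; apply: (leq_trans (size_sum _ _ _)); apply/bigmax_leqP => i _.
  exact: leq_trans (size_scale_leq _ _) (FN i).
apply: (leq_trans (size_polyD _ _)); rewrite geq_max !sum_le//.
- move=> r; apply: sum_le => j; apply: EN.
  by rewrite -ltnS (leq_trans (ltn_ord j))// ltnS leq_subr.
- move=> r; apply: EN; apply: leq_trans (leq_addr _ _).
  by rewrite -ltnS.
Qed.

Lemma tau_combB (E F : nat -> {poly R}) :
  tau_comb (fun r => E r - F r) = tau_comb E - tau_comb F.
Proof.
rewrite /tau_comb opprD addrACA -!sumrB; congr (_ + _).
  by apply: eq_bigr => r _; rewrite scalerBr.
apply: eq_bigr => r _; rewrite -scalerBr -sumrB; congr (_ *: _).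
by apply: eq_bigr => j _; rewrite scalerBr.
Qed.

Lemma band_op_tau_comb :
  band_op (tau_comb P) =
  tau_comb (fun r => 'X^r) - tau_comb (fun r => \sum_(j < theta) d r j *: 'X^j).
Proof.
rewrite -tau_combB /tau_comb band_opD !band_op_sum; congr (_ + _).
  by apply: eq_bigr => r _; rewrite band_opZ P_op.
apply: eq_bigr => r _; rewrite band_opZ band_op_sum; congr (_ *: _).
by apply: eq_bigr => j _; rewrite band_opZ P_op.
Qed.

(** The linear system of the Tau method is the vanishing of the total defect,
    coefficient by coefficient. *)
Lemma tau_comb_defect_coef (l : 'I_theta) :
  (tau_comb (fun r => \sum_(j < theta) d r j *: 'X^j))`_l =
  (tau_matrix n theta d *m tau - tau_rhs theta g d) l ord0.
Proof.
have dE r : (\sum_(j < theta) d r j *: 'X^j)`_l = d r l.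
  rewrite coef_sum (bigD1 l)//= coefZ coefXn eqxx mulr1 big1 ?addr0// => j jl.
  by rewrite coefZ coefXn val_eqE eq_sym (negbTE jl) mulr0.
rewrite !mxE opprK addrC /tau_comb coefD !coef_sum; congr (_ + _).
  by apply: eq_bigr => r _; rewrite coefZ dE.
apply: eq_bigr => r _; rewrite !mxE coefZ coef_sum mulrC; congr (_ * _).
by apply: eq_bigr => j _; rewrite coefZ dE.
Qed.

Lemma tau_comb_defect_eq0 :
  tau_comb (fun r => \sum_(j < theta) d r j *: 'X^j) = 0 <->
  tau_matrix n theta d *m tau = tau_rhs theta g d.
Proof.
split=> [D0|sys].
  apply/eqP; rewrite -subr_eq0; apply/eqP/colP => l.
  by rewrite -tau_comb_defect_coef D0 coef0 mxE.
apply/polyP => l; rewrite coef0; have [lt|tl] := ltnP l theta.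
  by rewrite (tau_comb_defect_coef (Ordinal lt)) sys subrr mxE.
rewrite nth_default//; apply: leq_trans tl; apply: size_tau_comb => r _.
by rewrite -(poly_def theta (fun j => d r j)) size_poly.
Qed.

End TauMethod.

Theorem theorem7 (R : realType) (p1 q1 p2 q2 : nat) (gamma beta : R)
    (n : nat) (g : 'I_n.+1 -> R) (h : 'M[R]_n.+1) (theta : nat)
    (p1_gt0 : (0 < p1)%N) (q1_gt0 : (0 < q1)%N) (co1 : coprime p1 q1)
    (p2_gt0 : (0 < p2)%N) (q2_gt0 : (0 < q2)%N) (co2 : coprime p2 q2)
    (gammaE : gamma = p1%:R / q1%:R) (betaE : beta = p2%:R / q2%:R)
    (gamma_gt0 : 0 < gamma) (gamma_le1 : gamma <= 1)
    (beta_gt0 : 0 < beta) (gamma_le_beta : gamma <= beta) :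
  let delta := lcmn q1 q2 in
  let alpha : R := delta%:R^-1 in
  let sigma1 := (p1 * delta %/ q1)%N in
  let sigma2 := (p2 * delta %/ q2)%N in
  let S := Scoef alpha sigma1 sigma2 h in
  is_height n S theta ->
  (forall r : nat, h ord0 ord0 * Beta gamma (1 - gamma + beta + r%:R * alpha) <> 1) ->
  forall (y : R -> R) (tau : 'cV[R]_theta),
    tau_solution gamma beta alpha g h y tau <->
    (tau_matrix n theta (dcoef S theta) *m tau = tau_rhs theta g (dcoef S theta)
     /\ forall t : R, 0 <= t ->
          y t =
          \sum_(r < n.+1) g r * psi alpha S theta r t
          + \sum_(r < theta) tau r ord0 *
              (\sum_(j < (n + theta - r).+1)
                 legC R (n + theta - r) j * psi alpha S theta j t)).
Proof.
move=> delta alpha sigma1 sigma2 S hS _ y tau.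
have delta_gt0 : (0 < delta)%N by rewrite lcmn_gt0 q1_gt0.
have alpha_gt0 : 0 < alpha by rewrite invr_gt0 ltr0n.
have gE : sigma1%:R * alpha = gamma.
  by rewrite gammaE lcm_exponentE// dvdn_lcml.
have bE : sigma2%:R * alpha = beta.
  by rewrite betaE lcm_exponentE// dvdn_lcmr.
have s1_gt0 : (0 < sigma1)%N by rewrite -(ltr0n R) -(pmulr_lgt0 _ alpha_gt0) gE.
have s12 : (sigma1 <= sigma2)%N.
  by rewrite -(ler_nat R) -(ler_pM2r alpha_gt0) gE bE.
have [_ _ S_top] := hS.
have [P PP] := psi_poly (Scoef_low alpha sigma1 sigma2 h) S_top alpha.
have P_size r : (size (P r) <= r.+1 - theta)%N by have [] := PP r.
have psiE r t : psi alpha S theta r t = (P r).[t `^ alpha] by have [_ ->] := PP r.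
have P_op r : band_op S theta (P r) =
    'X^r - \sum_(j < theta) dcoef S theta r j *: 'X^j by have [] := PP r.
pose Y := tau_comb g tau P.
pose D := tau_comb g tau (fun r => \sum_(j < theta) dcoef S theta r j *: 'X^j).
pose rhs := tau_comb g tau (fun r => 'X^r).
have YE t : Y.[t `^ alpha] =
    \sum_(r < n.+1) g r * psi alpha S theta r t
    + \sum_(r < theta) tau r ord0 *
        (\sum_(j < (n + theta - r).+1)
           legC R (n + theta - r) j * psi alpha S theta j t).
  rewrite /Y /tau_comb hornerD !horner_sum; congr (_ + _); apply: eq_bigr => r _.
    by rewrite hornerZ psiE.
  rewrite hornerZ horner_sum; congr (_ * _); apply: eq_bigr => j _.
  by rewrite hornerZ psiE.
have rhsE t : gtilde alpha g t + Hpert alpha n tau t = rhs.[t `^ alpha].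
  rewrite /rhs /tau_comb hornerD !horner_sum; congr (_ + _); apply: eq_bigr => r _.
    by rewrite hornerZ hornerXn powR_fracE.
  rewrite hornerZ horner_sum; congr (_ * _); apply: eq_bigr => j _.
  by rewrite hornerZ hornerXn powR_fracE.
have Y_op : band_op S theta Y = rhs - D by exact: band_op_tau_comb.
have LopE p t : (forall s, 0 <= s -> y s = p.[s `^ alpha]) -> 0 < t ->
    Lop gamma beta alpha h y t = (band_op S theta p).[t `^ alpha].
  by rewrite -gE -bE => yE t0; exact: Lop_poly.
have D_size : (size D <= theta)%N.
  apply: size_tau_comb => r _.
  by rewrite -(poly_def theta (fun j => dcoef S theta r j)) size_poly.
split=> [[/fracpoly_spanP[p _ yE] Ly]|[sys yE]].
  have p_op : band_op S theta p = rhs.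
    apply: (@poly_powR_inj _ alpha); first by rewrite gt_eqF.
    by move=> t t0; rewrite -(LopE p)// Ly.
  have pY : p = Y.
    apply/eqP; rewrite -subr_eq0; apply/eqP.
    apply: (band_op_small_eq0 S_top).
    by rewrite band_opB p_op Y_op subKr.
  split; last by move=> t t0; rewrite yE// pY YE.
  apply/tau_comb_defect_eq0; rewrite -/D.
  by apply/eqP; rewrite -(subKr rhs D) -Y_op -pY p_op subrr.
have D0 : D = 0 by apply/tau_comb_defect_eq0.
have yY s : 0 <= s -> y s = Y.[s `^ alpha] by move=> s0; rewrite yE// YE.
split.
  apply/fracpoly_spanP; exists Y => //.
  apply: size_tau_comb => r rn; apply: (leq_trans (P_size r)).
  by rewrite leq_subLR addnS ltnS addnC.
by move=> t t0; rewrite (LopE Y)// Y_op D0 subr0 rhsE.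
Qed.
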